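(* Let $K$ be a compact, linearly ordered, Gruenhage space. Then $K$ is metrisable.
   Context: All topological spaces are Hausdorff. A linearly ordered space is a linearly ordered set equipped with its order topology. A topological space $X$ is a Gruenhage space if there exist families $\mathscr{U}_n$, $n \in \mathbb{N}$, of open subsets of $X$ such that, given distinct $x,y \in X$, there exist $n \in \mathbb{N}$ and $U \in \mathscr{U}_n$ for which (i) $U \cap \{x,y\}$ is a singleton, and (ii) at least one of the points $x$, $y$ belongs to only finitely many elements of $\mathscr{U}_n$. *)

(* Defs.v *)
From HB Require Import structures.
From mathcomp Require Import all_boot all_order all_algebra.
From mathcomp Require Import all_classical all_reals all_analysis.
Set Implicit Arguments.
Unset Strict Implicit.
Unset Printing Implicit Defensive.
Import Order.TTheory GRing.Theory Num.Theory.
Local Open Scope classical_set_scope.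

(* Hausdorffness is not part of this predicate: for the spaces it is applied
   to, it follows from the order topology, see [order_hausdorff]. *)
Definition gruenhage_space (X : topologicalType) : Prop :=
  exists U_ : nat -> set (set X),
    (forall n, U_ n `<=` open) /\
    (forall x y : X, x <> y ->
       exists n, exists2 U, U_ n U &
         (exists z, U `&` [set x; y] = [set z]) /\
         (finite_set [set V | U_ n V /\ V x] \/
          finite_set [set V | U_ n V /\ V y])).

(* [m] is a metric structure on the carrier of [X] (a [metricType R] with the
   same underlying type); it comes with its own neighbourhoods, which are
   required to be those of [X]. *)
Definition metrisable (R : realType) (X : topologicalType) : Prop :=
  exists m : Metric.axioms_ R X,
    forall x : X, @nbhs X (Metric.Pack m) x = @nbhs X X x.

(* Main.v *)
Require Import Defs.
From HB Require Import structures.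
From mathcomp Require Import all_boot all_order all_algebra.
From mathcomp Require Import all_classical all_reals all_analysis.
From mathcomp Require Import lra.
Set Implicit Arguments.
Unset Strict Implicit.
Unset Printing Implicit Defensive.
Import Order.TTheory GRing.Theory Num.Theory.
Import numFieldNormedType.Exports.
Local Open Scope classical_set_scope.

(** Let U_n be Gruenhage families for K, and write N_n(x) for the set of members
    of U_n that contain x.  The set C(n, k) where N_n has fewer than k elements
    is closed, because having k members around a point is an open condition.
    On the layer where N_n has exactly k elements, N_n is locally constant
    relative to C(n, k+1), because a nearby point belongs to the same k members
    and to no further one.  Of two distinct points one lies in a finite number
    k of members of some U_n, and some member contains just one of them; so they
    are told apart either by C(n, k) or C(n, k+1) or, when they lie in the same
    layer, by the value of N_n.  This data is a [stratification]; it is all that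
    is used of the Gruenhage property.

    A compact linearly ordered K with a stratification has countable cofinality
    and coinitiality at each point ([countable_coinitiality]).  Suppose every
    countable set of points above a has a lower bound above a.  Starting close
    enough to a, one builds a decreasing sequence each step of which jumps below
    witnesses, chosen for all (n, k) at once, of what the strata and the values
    N_n do between a and the previous term.  The infimum b of the sequence then
    lies in exactly those C(n, k) that accumulate at a, and for each layer that
    contains b, N_n is constant on the part of C(n, k+1) in ]a, b].  Two such
    points, the second built below the first, cannot be told apart
    ([no_uncountable_coinitiality]).

    A countable set D that meets each [x, y] with x < y in two points
    ([countable_order_separation]) is obtained as follows.  D contains the end
    points of K and is closed under countably many operations: the nearest point
    of C(n, k) above or below a given point, the next point of C(n, k+1)
    that leaves the layer of the given point or its value of N_n, and the terms
    of the countable sequences provided by the first step.  If D missed [x, y],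
    the supremum a of D below x and the infimum b of D above y would be limits
    of D.  A stratum containing only one of a and b, or a change of N_n between
    a and b, would force one of the operations to put a point of D into [a, b]
    ([no_gap_between_limits]).

    Urysohn functions attached to the pairs of D form a countable family of
    continuous functions separating points, and on a compact space such a family
    defines a metric inducing the topology
    ([compact_countably_separated_metrisable]). *)

(** * Stratifications from Gruenhage families *)

(** Countably many closed sets, with colours on the layers between consecutive
    ones, replace the families of open sets, which may be uncountable; that
    there are only countably many conditions to reflect is what the arguments
    below rest on. *)
Record stratification (X : topologicalType) (T : Type)
    (C : nat -> nat -> set X) (col : nat -> X -> T) : Prop := Stratification {
  strat_closed : forall n k, closed (C n k);
  strat_locally_const : forall n k x, C n k.+1 x -> ~ C n k x ->
    \forall q \near x, C n k.+1 q -> col n q = col n x;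
  strat_separates : forall x y, x <> y -> exists n k,
    [\/ C n k x /\ ~ C n k y, C n k y /\ ~ C n k x |
     [/\ C n k.+1 x, ~ C n k x, C n k.+1 y, ~ C n k y & col n x <> col n y]]
}.

Lemma strat_nbhsC (X : topologicalType) (T : Type) (C : nat -> nat -> set X)
    (col : nat -> X -> T) (n k : nat) (x : X) :
  stratification C col -> ~ C n k x -> nbhs x (~` C n k).
Proof.
move=> CS nCx; apply: open_nbhs_nbhs; split => //.
exact/closed_openC/(strat_closed CS).
Qed.

Section GruenhageStratification.
Variable X : topologicalType.

Definition members_at (W : set (set X)) (x : X) : set (set X) :=
  [set V | W V /\ V x].

(** Counting by duplicate-free lists makes the condition on [x] meaningful also
    when infinitely many members contain [x]. *)
Definition fewer_than (W : set (set X)) (k : nat) : set X :=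
  [set x | forall s : seq (set X), uniq s -> [set` s] `<=` members_at W x ->
     (size s < k)%N].

Lemma near_members (W : set (set X)) (x : X) (s : seq (set X)) :
  W `<=` open -> [set` s] `<=` members_at W x ->
  \forall q \near x, [set` s] `<=` members_at W q.
Proof.
move=> Wop; elim: s => [|V s IH] sx; first by near=> q => V.
have /sx[WV Vx] : [set` V :: s] V by rewrite /= mem_head.
have {}IH : \forall q \near x, [set` s] `<=` members_at W q.
  by apply: IH => V' /= V's; apply: sx; rewrite /= inE V's orbT.
have nV : nbhs x V by apply: open_nbhs_nbhs; split => //; exact: Wop.
apply: filterS2 IH nV => q sq Vq V' /=; rewrite inE => /orP[/eqP ->//|].
exact: sq.
Unshelve. all: by end_near. Qed.

Lemma members_enum (W : set (set X)) (k : nat) (x : X) :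
  fewer_than W k.+1 x -> ~ fewer_than W k x ->
  exists2 s : seq (set X), uniq s /\ size s = k & members_at W x = [set` s].
Proof.
move=> xk /existsNP[s /not_implyP[us /not_implyP[sx /negP]]].
rewrite -leqNgt => ks.
have sk : size s = k by apply/eqP; rewrite eqn_leq ks andbT -ltnS xk.
exists s => //; apply/seteqP; split => // V xV /=; apply: contraT => Vs.
have := xk (V :: s); rewrite /= Vs us sk ltnn; apply => // V' /=.
by rewrite inE => /orP[/eqP ->//|/sx].
Qed.

Lemma fewer_than_closed (W : set (set X)) (k : nat) :
  W `<=` open -> closed (fewer_than W k).
Proof.
move=> Wop x xk; apply: contrapT.
move=> /existsNP[s /not_implyP[us /not_implyP[sx sk]]].
by have [y [ky /(ky _ us)]] := xk _ (near_members Wop sx).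
Qed.

(** A point near [x] lies in the [k] members that contain [x], and if it lies in
    at most [k] members altogether there is no room for another one. *)
Lemma members_locally_const (W : set (set X)) (k : nat) (x : X) :
  W `<=` open -> fewer_than W k.+1 x -> ~ fewer_than W k x ->
  \forall q \near x, fewer_than W k.+1 q -> members_at W q = members_at W x.
Proof.
move=> Wop xk /(members_enum xk)[s [us sk] xs].
have : \forall q \near x, [set` s] `<=` members_at W q.
  by apply: near_members; rewrite ?xs.
apply: filterS => q sq qk.
have qNk : ~ fewer_than W k q by move=> /(_ s us sq); rewrite sk ltnn.
have [t [ut tk] qt] := members_enum qk qNk.
have st : {subset s <= t} by move=> V /sq; rewrite qt.
rewrite xs qt; apply/seteqP; split => V /=; last exact: st.
by have [_ ->] := uniq_min_size us st (eq_leq (etrans tk (esym sk))).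
Qed.

Lemma finite_members_stratum (W : set (set X)) (x : X) :
  finite_set (members_at W x) ->
  exists k, fewer_than W k.+1 x /\ ~ fewer_than W k x.
Proof.
move=> /finite_seqP[s xs]; exists (size (undup s)); split.
  move=> t ut tx; rewrite ltnS uniq_leq_size// => V Vt.
  by have /tx := Vt; rewrite xs /= mem_undup.
have sx : [set` undup s] `<=` members_at W x.
  by rewrite xs => V /=; rewrite mem_undup.
by move=> /(_ _ (undup_uniq s) sx); rewrite ltnn.
Qed.

(** With [k] members through [x], either the number of members through [y] falls
    on another side of [k] or [k.+1], or both points have [k] members, and then
    [U] belongs to only one of the two lists. *)
Lemma finite_members_separation (W : set (set X)) (x y : X) (U : set X) :
  W U -> ~ (U x <-> U y) -> finite_set (members_at W x) ->
  exists k,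
    [\/ fewer_than W k x /\ ~ fewer_than W k y,
        fewer_than W k y /\ ~ fewer_than W k x |
     [/\ fewer_than W k.+1 x, ~ fewer_than W k x, fewer_than W k.+1 y,
         ~ fewer_than W k y & members_at W x <> members_at W y]].
Proof.
move=> WU Uxy /finite_members_stratum[k [xk xNk]].
have [yk|yNk] := pselect (fewer_than W k.+1 y); last first.
  by exists k.+1; apply: Or31.
exists k; have [yk'|yNk'] := pselect (fewer_than W k y); first exact: Or32.
apply: Or33; split => // xy; apply: Uxy.
have : members_at W x U <-> members_at W y U by rewrite xy.
by rewrite /members_at/=; tauto.
Qed.

End GruenhageStratification.

Lemma gruenhage_stratification (X : topologicalType) :
  gruenhage_space X ->
  exists (C : nat -> nat -> set X) (col : nat -> X -> set (set X)),
    stratification C col.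
Proof.
move=> [W [Wop Wsep]].
exists (fun n k => fewer_than (W n) k), (fun n x => members_at (W n) x).
split=> [n k|n k x|x y xy]; first exact: fewer_than_closed.
  exact: members_locally_const.
have [n [U WU [[z Uz] fin]]] := Wsep x y xy.
have Uxy : ~ (U x <-> U y).
  move=> Uxy; have [Uz1 zxy] : (U `&` [set x; y]) z by rewrite Uz.
  have Ux : U x by case: zxy Uz1 => -> // /Uxy.
  have Uy : U y by apply/Uxy.
  have xz : [set z] x by rewrite -Uz; split => //; left.
  have yz : [set z] y by rewrite -Uz; split => //; right.
  by apply: xy; rewrite xz yz.
exists n; case: fin => [fx|fy].
  exact: finite_members_separation WU Uxy fx.
have Uyx : ~ (U y <-> U x) by tauto.
have [k] := finite_members_separation WU Uyx fy.
move=> H; exists k; case: H => [?|?|[? ? ? ? yx]]; [exact: Or32|exact: Or31|].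
by apply: Or33; split => // /esym.
Qed.

(** * Closed sets in a compact order, in either direction *)

(** The order of [K] or its reverse, so that each one-sided statement below is
    proved once and used on both sides of a point. *)
Definition dir {d} {K : orderTopologicalType d} (o : bool) : rel K :=
  if o then <=%O else >=%O.
Arguments dir : simpl never.

Section DirectedOrder.
Context {d : Order.disp_t} {K : orderTopologicalType d} {o : bool}.
Local Notation le := (@dir d K o).

Lemma dir_refl x : le x x.
Proof. by rewrite /dir; case: o; exact: lexx. Qed.

Lemma dir_trans y x z : le x y -> le y z -> le x z.
Proof.
rewrite /dir; case: o => /= xy yz.
- exact: le_trans xy yz.
- exact: le_trans yz xy.
Qed.

Lemma dir_anti x y : le x y -> le y x -> x = y.
Proof. by rewrite /dir; case: o => xy yx; apply/le_anti/andP. Qed.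

Lemma dirNge x y : ~ le x y -> le y x.
Proof. by rewrite /dir; case: o => /negP; rewrite -ltNge => /ltW. Qed.

Lemma dir_closed_lower a : closed [set t | le t a].
Proof.
rewrite /dir; case: o.
- rewrite (_ : [set t | _] = `]-oo, a]); first exact: lray_closed.
  by apply/seteqP; split => t /=; rewrite in_itv.
- rewrite (_ : [set t | _] = `[a, +oo[); first exact: rray_closed.
  by apply/seteqP; split => t /=; rewrite in_itv/= andbT.
Qed.

Lemma dir_closed_upper a : closed [set t | le a t].
Proof.
rewrite /dir; case: o.
- rewrite (_ : [set t | _] = `[a, +oo[); first exact: rray_closed.
  by apply/seteqP; split => t /=; rewrite in_itv/= andbT.
- rewrite (_ : [set t | _] = `]-oo, a]); first exact: lray_closed.
  by apply/seteqP; split => t /=; rewrite in_itv.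
Qed.

Lemma dir_convex_nbhs (x : K) (U : set K) : nbhs x U -> exists V : set K,
  [/\ nbhs x V, V `<=` U &
      forall p q t, V p -> V q -> le p t -> le t q -> V t].
Proof.
rewrite itv_nbhsE => -[i [oi xi] iU]; exists [set` i]; split => //.
  by exists i.
have iconv p q t : p \in i -> q \in i -> (p <= t)%O -> (t <= q)%O -> t \in i.
  case: i {oi xi iU} => l r; rewrite !itv_boundlr.
  move=> /andP[lp _] /andP[_ qr] pt tq; apply/andP; split.
    by apply: le_trans lp _; rewrite bnd_simp.
  by apply: le_trans qr; rewrite bnd_simp.
rewrite /dir; case: o => p q t pi qi pt tq.
- exact: (iconv p q).
- exact: (iconv q p).
Qed.

(** The traces of [A] on the lower rays of its points form a filter base of
    relatively closed sets, and a cluster point of it is below all of [A]. *)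
Lemma compact_least (A : set K) : compact A -> A !=set0 ->
  exists2 m, A m & forall t, A t -> le m t.
Proof.
move=> cA [a0 Aa0]; pose B a := A `&` [set t | le t a].
have FF : ProperFilter (filter_from A B).
  apply: filter_from_proper; last first.
    by move=> a Aa; exists a; split => //; exact: dir_refl.
  apply: filter_from_filter; first by exists a0.
  move=> x y Ax Ay.
  have [xy|/dirNge yx] := pselect (le x y).
  - exists x => // t [At tx].
    by split; split => //; exact: dir_trans tx xy.
  - exists y => // t [At tx].
    by split; split => //; exact: dir_trans tx yx.
have [|m [Am clm]] := cA _ FF; first by exists a0 => // t [].
exists m => // t At; apply: dir_closed_lower => V nV.
have FB : filter_from A B (B t) by exists t.
by have [s [[_ st] Vs]] := clm (B t) V FB nV; exists s.
Qed.

Hypothesis cK : compact [set: K].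

Lemma closed_least (A : set K) : closed A -> A !=set0 ->
  exists2 m, A m & forall t, A t -> le m t.
Proof. by move=> cA; apply/compact_least/(subclosed_compact cA cK). Qed.

(** The last clause is the form in which topology enters below: a neighbourhood
    of the infimum contains the whole interval up to some element of [A]. *)
Lemma exists_inf (A : set K) : A !=set0 -> exists b,
  [/\ forall s, A s -> le b s, forall t, (forall s, A s -> le t s) -> le t b &
      forall U, nbhs b U -> exists2 s, A s & forall t, le b t -> le t s -> U t].
Proof.
move=> [a0 Aa0]; have [|m clm ml] := closed_least (@closed_closure _ A).
  by exists a0; exact: subset_closure.
have mA s : A s -> le m s by move=> As; exact/ml/subset_closure.
exists m; split=> // [t tA|U /dir_convex_nbhs[V [nV VU Vconv]]].
  apply: (dir_closed_upper (a := t)); apply: closure_subset clm => s As.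
  exact: tA.
have [s [As Vs]] := clm V nV; exists s => // t mt ts.
by apply/VU/(Vconv m s) => //; exact: nbhs_singleton.
Qed.

Definition first_from (A : set K) (x : K) : K :=
  xget x [set m | [/\ A m, le x m & forall t, A t -> le x t -> le m t]].

Lemma first_fromP (A : set K) (x t : K) : closed A -> A t -> le x t ->
  [/\ A (first_from A x), le x (first_from A x) & le (first_from A x) t].
Proof.
move=> cA At xt.
have [||m [Am xm] mmin] := @closed_least (A `&` [set s | le x s]).
- by apply: closedI => //; exact: dir_closed_upper.
- by exists t.
rewrite /first_from; case: xgetP => [f _ [Af xf fmin]|/(_ m)[]].
  by split => //; exact: fmin.
by split => // s As xs; exact: mmin.
Qed.

End DirectedOrder.
Arguments first_from {d K} o A x.

Lemma exists_sup {d : Order.disp_t} {K : orderTopologicalType d} {o : bool}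
    (A : set K) : compact [set: K] -> A !=set0 -> exists b,
  [/\ forall s, A s -> dir o s b,
      forall t, (forall s, A s -> dir o s t) -> dir o b t &
      forall U, nbhs b U ->
        exists2 s, A s & forall t, dir o t b -> dir o s t -> U t].
Proof.
move=> cK A0; case: o.
- exact: (exists_inf (o := false) cK A0).
- exact: (exists_inf (o := true) cK A0).
Qed.

(** * Countable coinitiality *)

Section Coinitiality.
Context {d : Order.disp_t} {K : orderTopologicalType d} {o : bool}.
Local Notation le := (@dir d K o).
Local Notation lt x y := (~ dir o y x).
Hypothesis cK : compact [set: K].
Context {T : Type} {C : nat -> nat -> set K} {col : nat -> K -> T}.
Hypothesis CS : stratification C col.

Section UncountableCoinitiality.
Variable a : K.
Hypothesis unc : forall r : nat -> K,
  exists2 t, lt a t & forall n, lt a (r n) -> lt t (r n).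

Lemma below_countable (I : countType) (r : I -> K) :
  exists2 t, lt a t & forall i, lt a (r i) -> lt t (r i).
Proof.
have [t at_ tr] := unc (fun n => if unpickle n is Some i then r i else a).
by exists t => // i; have := tr (pickle i); rewrite pickleK.
Qed.

(** Countably many binary properties that hold somewhere in ]a, s] hold already
    in a smaller ]s', s] with a < s': it suffices to descend below one
    witnessing pair for each. *)
Lemma reflect_below (I : countType) (Q : I -> K -> K -> Prop) s : lt a s ->
  exists s', [/\ lt a s', lt s' s & forall i,
    (exists x y, [/\ lt a x /\ le x s, lt a y /\ le y s & Q i x y]) ->
    exists x y, [/\ lt s' x /\ le x s, lt s' y /\ le y s & Q i x y]].
Proof.
move=> as_.
have /choice[p pP] : forall i, exists p : K * K,
    (exists x y, [/\ lt a x /\ le x s, lt a y /\ le y s & Q i x y]) ->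
    [/\ lt a p.1 /\ le p.1 s, lt a p.2 /\ le p.2 s & Q i p.1 p.2].
  move=> i; have [[x [y xy]]|nP] := pselect (exists x y,
    [/\ lt a x /\ le x s, lt a y /\ le y s & Q i x y]); first by exists (x, y).
  by exists (a, a).
have [s' as' s'lt] := below_countable (fun w : option (I * bool) =>
  if w is Some (i, b) then if b then (p i).1 else (p i).2 else s).
exists s'; split => //; first exact: (s'lt None).
move=> i /pP[[a1 s1] [a2 s2] Qi]; exists (p i).1, (p i).2; split => //.
  by split => //; exact: (s'lt (Some (i, true))).
by split => //; exact: (s'lt (Some (i, false))).
Qed.

Definition clusters_at_base n k :=
  forall t, lt a t -> exists c, [/\ C n k c, lt a c & le c t].

(** The position of [b] in the strata and its colours are dictated by what
    happens in ]a, b], so that two such points close to [a] look the same. *)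
Lemma generic_point s : lt a s -> exists b, [/\ lt a b, lt b s,
  forall n k, clusters_at_base n k -> C n k b &
  forall n k, C n k.+1 b -> ~ C n k b ->
    forall x, C n k.+1 x -> lt a x -> le x b -> col n x = col n b].
Proof.
move=> as_.
(* The flag selects between meeting C n k and meeting it in two colours. *)
pose Q (i : nat * nat * bool) x y := let: (n, k, b) := i in
  C n k x /\ (b -> C n k y /\ col n x <> col n y).
have /choice[f fP] : forall s, exists s', lt a s ->
    [/\ lt a s', lt s' s & forall i,
    (exists x y, [/\ lt a x /\ le x s, lt a y /\ le y s & Q i x y]) ->
    exists x y, [/\ lt s' x /\ le x s, lt s' y /\ le y s & Q i x y]].
  move=> z; have [az|naz] := pselect (lt a z); last by exists z.
  by have [z' z'P] := reflect_below Q az; exists z'.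
pose u j := iter j f s.
have au j : lt a (u j) by elim: j => // j /fP[].
have [|b [bu binf bnbhs]] := exists_inf (o := o) cK (A := range u).
  by exists s, 0.
have ub j : le b (u j) by apply: bu; exists j.
have bbetween j x : lt (u j.+1) x -> le b x.
  by move=> jx; exact: dir_trans (ub j.+1) (dirNge jx).
have [t at_ tu] := below_countable u.
have tb : le t b by apply: binf => _ [j _ <-]; exact/dirNge/tu.
exists b; split.
- by move=> ba; apply: at_; exact: dir_trans tb ba.
- have [_ u1s _] := fP s as_.
  by move=> sb; apply: u1s; exact: dir_trans sb (ub 1).
- move=> n k acc; apply: contrapT => nCb.
  have [_ [j _ <-] jC] := bnbhs _ (strat_nbhsC CS nCb).
  have [c [Cc ac cj]] := acc (u j) (au j).
  have [_ _ /(_ (n, k, false))[]] := fP _ (au j); first by exists c, c; split.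
  move=> x [y [[jx xj] _ [Cx _]]].
  by apply: (jC x) => //; exact: bbetween jx.
- move=> n k Cb nCb x Cx ax xb; apply: contrapT => xbN.
  have [_ [j _ <-] jC] := bnbhs _ (strat_locally_const CS Cb nCb).
  (* x and b have different colours in ]a, u j], hence so do two points of
     ]u j.+1, u j], where the colour is that of b. *)
  have [_ _ /(_ (n, k.+1, true))[]] := fP _ (au j).
    exists x, b; split; [|split|by []] => //.
      by split => //; exact: dir_trans xb (ub j).
    by move=> ba; apply: ax; exact: dir_trans xb ba.
  move=> x' [y' [[jx xj] [jy yj] [Cx' /(_ isT)[Cy' xy']]]]; apply: xy'.
  have bx := bbetween j _ jx; have byy := bbetween j _ jy.
  by rewrite (jC x' bx xj Cx') (jC y' byy yj Cy').
Qed.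

(** The second of two generic points is chosen below the first, so that the
    colour of the first already governs it. *)
Lemma no_uncountable_coinitiality : False.
Proof.
have [t1 at1 _] := below_countable (fun _ : nat => a).
have /choice[r rP] : forall i : nat * nat, exists t, lt a t /\
    (clusters_at_base i.1 i.2 \/
     forall c, C i.1 i.2 c -> lt a c -> ~ le c t).
  move=> [n k]; have [acc|] := pselect (clusters_at_base n k).
    by exists t1; split => //; left.
  move=> /existsNP[t /not_implyP[at_ nacc]]; exists t; split => //; right.
  by move=> c Cc ac ct; apply: nacc; exists c.
(* Below t0, the strata that do not accumulate at a are absent. *)
have [t0 at0 t0r] := below_countable r.
have [b1 [ab1 b1t0 b1acc b1col]] := generic_point at0.
have [b2 [ab2 b2b1 b2acc b2col]] := generic_point ab1.
have CE b n k : lt a b -> le b t0 -> (clusters_at_base n k -> C n k b) ->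
    (C n k b <-> clusters_at_base n k).
  move=> ab bt0 accb; split => // Cb.
  have [ar [//|nacc]] := rP (n, k).
  exfalso; apply: (nacc b Cb ab).
  exact: dir_trans bt0 (dirNge (t0r _ ar)).
have b2t0 : le b2 t0 by exact: dir_trans (dirNge b2b1) (dirNge b1t0).
have C1 n k := CE b1 n k ab1 (dirNge b1t0) (b1acc n k).
have C2 n k := CE b2 n k ab2 b2t0 (b2acc n k).
have b12 : b1 <> b2 by move=> b12; apply: b2b1; rewrite b12; exact: dir_refl.
have [n [k [[/C1 /C2 //]|[/C2 /C1 //]|[Cb1 nCb1 Cb2 nCb2]]]] :=
  strat_separates CS b12.
by apply; rewrite (b1col _ _ Cb1 nCb1 b2)//; exact: dirNge.
Qed.

End UncountableCoinitiality.

Lemma countable_coinitiality (a : K) : exists r : nat -> K,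
  forall t, ~ le t a -> exists n, ~ le (r n) a /\ le (r n) t.
Proof.
apply: contrapT => /forallNP unc; apply: (@no_uncountable_coinitiality a) => r.
have /existsNP[t /not_implyP[at_ /forallNP tr]] := unc r.
by exists t => // n arn rt; exact: (tr n).
Qed.

End Coinitiality.

(** * A countable set with two points in every interval *)

Lemma countable_hull (I : countType) (T : Type) (A : set T) (g : I -> T -> T) :
  countable A -> exists D : set T,
    [/\ countable D, A `<=` D & forall i x, D x -> D (g i x)].
Proof.
move=> cA; exists (\bigcup_(s in [set: seq I]) (fun x => foldr g x s) @` A).
split.
- apply: bigcup_countable => [|s _]; first exact: countableP.
  exact: card_le_trans (card_image_le _ _) cA.
- by move=> x Ax; exists [::] => //; exists x.
- by move=> i _ [s _ [x Ax <-]]; exists (i :: s) => //; exists x.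
Qed.

Section Gap.
Context {d : Order.disp_t} {K : orderTopologicalType d} {o : bool}.
Local Notation le := (@dir d K o).
Hypothesis cK : compact [set: K].
Variable D : set K.

(** The first point of [A] from [e] on lies beyond [a], yet not beyond [b]. *)
Lemma gap_first (A : set K) (e a b : K) :
  closed A -> A b -> (forall t, le e t -> le t a -> ~ A t) -> le e a ->
  le a b -> D (first_from o A e) -> ~ (forall t, D t -> ~ (le a t /\ le t b)).
Proof.
move=> cA Ab Aea ea ab Df gap.
have [Af ef fb] := first_fromP cK cA Ab (dir_trans ea ab).
have [fa|/dirNge af] := pselect (le (first_from o A e) a).
  exact: Aea fa Af.
exact: gap Df _.
Qed.

(** The first hypothesis is what countable coinitiality provides; it excludes
    that the supremum of [D] below the gap belongs to [D]. *)
Lemma gap_end (x y : K) :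
  (forall c, D c -> ~ le y c -> exists e, [/\ D e, ~ le e c & le e y]) ->
  le x y -> x <> y -> (exists2 e, D e & le e x) ->
  (forall t, D t -> ~ (le x t /\ le t y)) ->
  exists a, [/\ le a x, forall t, D t -> ~ (le a t /\ le t y) &
    forall U, nbhs a U ->
      exists2 e, D e & le e a /\ forall t, le e t -> le t a -> U t].
Proof.
move=> Dstep xy nxy [e0 De0 e0x] gap.
have Dx t : D t -> le t y -> le t x.
  by move=> Dt ty; apply: dirNge => xt; apply: (gap t).
have [|a [aub amin anbhs]] :=
    exists_sup (o := o) (A := D `&` [set t | le t x]) cK.
  by exists e0.
exists a; split.
- by apply: amin => s [].
- move=> t Dt [at_ ty].
  have tx := Dx t Dt ty.
  have ta : le t a by apply: aub; split.
  have a_t : a = t := dir_anti at_ ta.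
  have [|e [De et ey]] := Dstep t Dt.
    by move=> yt; apply: nxy; exact: dir_anti xy (dir_trans yt tx).
  by apply: et; rewrite -a_t; apply: aub; split => //; exact: Dx.
- move=> U /anbhs[e [De ex] eU]; exists e => //.
  split; first by apply: aub; split.
  by move=> t et ta; exact: eU.
Qed.

End Gap.

Section CountableSeparation.
Context {d : Order.disp_t} {K : orderTopologicalType d} {T : Type}.
Context {C : nat -> nat -> set K} {col : nat -> K -> T}.
Hypothesis cK : compact [set: K].
Hypothesis CS : stratification C col.

(** Adding [C n k] makes the set closed: the colour is locally constant only on
    the layer. *)
Definition other_color n k (c : K) : set K :=
  [set t | C n k t \/ C n k.+1 t /\ col n t <> col n c].

Lemma other_color_closed n k c : closed (other_color n k c).
Proof.
move=> p pcl; apply: contrapT => /not_orP[nCp /not_andP np].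
have [Cp1|nCp1] := pselect (C n k.+1 p).
  have pc : col n p = col n c by case: np => // /contrapT.
  have [t [[Ct|[Ct tc]] [nCt tp]]] := pcl _
    (filterI (strat_nbhsC CS nCp) (strat_locally_const CS Cp1 nCp)) => //.
  by apply: tc; rewrite tp.
by have [t [[Ct|[Ct _]] [nCt nCt1]]] :=
  pcl _ (filterI (strat_nbhsC CS nCp) (strat_nbhsC CS nCp1)).
Qed.

Lemma no_gap_between_limits (D : set K) (a b : K) :
  (forall o n k e, D e -> D (first_from o (C n k) e)) ->
  (forall n k e, D e -> D (first_from true (other_color n k e) e)) ->
  (forall U, nbhs a U ->
     exists2 e, D e & (e <= a)%O /\
       forall t, (e <= t)%O -> (t <= a)%O -> U t) ->
  (forall U, nbhs b U ->
     exists2 e, D e & (b <= e)%O /\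
       forall t, (t <= e)%O -> (b <= t)%O -> U t) ->
  (a < b)%O -> ~ (forall t, D t -> ~ ((a <= t)%O /\ (t <= b)%O)).
Proof.
move=> DC Dcol alim blim ab gap.
have aleb := ltW ab.
have neq_ab : a <> b by move=> ab'; rewrite ab' ltxx in ab.
have [n [k [[Ca nCb]|[Cb nCa]|[Ca nCa Cb nCb col_ab]]]] :=
  strat_separates CS neq_ab.
- (* The last point of C n k before e lies in the gap. *)
  have [e De [be eC]] := blim _ (strat_nbhsC CS nCb).
  apply: (gap_first (o := false) cK (strat_closed CS (n := n) (k := k))
    (e := e) (a := b) (b := a) (D := D)) => //.
  + exact: (DC false n k e De).
  + by move=> t Dt [tb at_]; exact: (gap t).
- have [e De [ea eC]] := alim _ (strat_nbhsC CS nCa).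
  apply: (gap_first (o := true) cK (strat_closed CS (n := n) (k := k))
    (e := e) (a := a) (b := b) (D := D)) => //.
  exact: (DC true n k e De).
- have [e De [ea eC]] :=
    alim _ (filterI (strat_nbhsC CS nCa) (strat_locally_const CS Ca nCa)).
  (* A point c of D that stands for the colour of a, which need not be in D. *)
  have [Cc ec ca] :=
    first_fromP (o := true) cK (strat_closed CS (n := n) (k := k.+1)) Ca ea.
  have Dc := DC true n k.+1 e De.
  set c := first_from _ _ _ in Cc ec ca Dc.
  have [_ /(_ Cc) ca_col] := eC c ec ca.
  apply: (gap_first (o := true) cK (@other_color_closed n k c)
    (e := c) (a := a) (b := b) (D := D)) => //.
  + by right; split => //; rewrite ca_col => /esym.
  + move=> t ct ta; have [nCt tcol] := eC t (le_trans ec ct) ta.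
    by case=> // -[/tcol ->]; rewrite ca_col.
  + exact: Dcol.
Qed.

Lemma countable_order_separation : exists2 D : set K, countable D &
  forall x y, (x < y)%O ->
    exists e f, [/\ D e, D f, (x <= e)%O, (e < f)%O & (f <= y)%O].
Proof.
have [[x0 _]|K0] := pselect ([set: K] !=set0); last first.
  by exists set0 => // x; exfalso; apply: K0; exists x.
have extr o : exists2 m, [set: K] m & forall t, [set: K] t -> dir o m t.
  by apply: (closed_least (o := o) cK); [exact: closedT|exists x0].
have [[bot _ botP] [top _ topP]] := (extr true, extr false).
have /choice[r rP] : forall oa : bool * K, exists r : nat -> K,
    forall t, ~ dir oa.1 t oa.2 -> exists n,
      ~ dir oa.1 (r n) oa.2 /\ dir oa.1 (r n) t.
  by move=> [side a]; exact: (countable_coinitiality (o := side) cK CS).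
pose g (i : bool * (nat * nat) + nat * nat + bool * nat) (x : K) : K :=
  match i with
  | inl (inl (o, (n, k))) => first_from o (C n k) x
  | inl (inr (n, k)) => first_from true (other_color n k x) x
  | inr (o, n) => r (o, x) n
  end.
have [D [cD botD Dg]] := @countable_hull _ _ [set bot; top] g
  (finite_set_countable (finite_set2 bot top)).
exists D => // x y xy.
have Dstep o c t : D c -> ~ dir o t c ->
    exists e, [/\ D e, ~ dir o e c & dir o e t].
  move=> Dc tc; have [n [rc rt]] := rP (o, c) t tc.
  by exists (r (o, c) n); split => //; exact: (Dg (inr (o, n))).
have [e [De xe ey]] : exists e, [/\ D e, (x <= e)%O & (e <= y)%O].
  apply: contrapT => nD.
  have gap t : D t -> ~ ((x <= t)%O /\ (t <= y)%O).
    by move=> Dt [xt ty]; apply: nD; exists t.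
  have nxy : x <> y by move=> xy'; rewrite xy' ltxx in xy.
  have below_x : exists2 e, D e & dir true e x.
    by exists bot; [apply: botD; left|exact: botP].
  have [a [ax agap alim]] := gap_end (o := true) cK (D := D)
    (fun c => Dstep true c y) (ltW xy) nxy below_x gap.
  have ay : (a < y)%O by exact: le_lt_trans ax xy.
  have nya : y <> a by move=> ya; rewrite ya ltxx in ay.
  have above_y : exists2 e, D e & dir false e y.
    by exists top; [apply: botD; right|exact: topP].
  have gap' t : D t -> ~ (dir false y t /\ dir false t a).
    by move=> Dt [ty at_]; exact: (agap t).
  have [b [yb bgap blim]] := gap_end (o := false) cK (D := D)
    (fun c => Dstep false c a) (ltW ay) nya above_y gap'.
  apply: (no_gap_between_limits (D := D) (a := a) (b := b)) => //.
  - by move=> o n k e; exact: (Dg (inl (inl (o, (n, k))))).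
  - by move=> n k e; exact: (Dg (inl (inr (n, k)))).
  - exact: lt_le_trans ay yb.
  - by move=> t Dt [at_ tb]; exact: (bgap t).
(* One point of D in [x, y] yields a second one, on whichever side is left. *)
have [ye|ley] := leP y e.
  have [|f [Df fe xf]] := Dstep false e x De.
    by apply/negP; rewrite -ltNge; exact: lt_le_trans xy ye.
  by exists f, e; split => //; rewrite ltNge; exact/negP.
have [|f [Df fe fy]] := Dstep true e y De.
  by apply/negP; rewrite -ltNge.
by exists e, f; split => //; rewrite ltNge; exact/negP.
Qed.

End CountableSeparation.

(** * Metrisation *)

Section SupMetric.
Local Open Scope ring_scope.
Context {R : realType} {X : topologicalType} (f : nat -> X -> R).
Hypothesis f01 : forall n x, 0 <= f n x <= 1.

Definition weighted_gap (x y : X) (n : nat) : R := 2^-1 ^+ n * `|f n x - f n y|.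

Definition sup_dist (x y : X) : R := sup (range (weighted_gap x y)).

Lemma weighted_gap_ge0 x y n : 0 <= weighted_gap x y n.
Proof. by rewrite mulr_ge0// exprn_ge0. Qed.

Lemma weighted_gap_le x y n : weighted_gap x y n <= 2^-1 ^+ n.
Proof.
rewrite -[leRHS]mulr1 ler_wpM2l ?exprn_ge0// ler_norml.
have := f01 n x; have := f01 n y; lra.
Qed.

Lemma weighted_gap_le_sup_dist x y n : weighted_gap x y n <= sup_dist x y.
Proof.
apply: ub_le_sup; last by exists n.
exists 1 => _ [m _ <-]; apply: le_trans (weighted_gap_le x y m) _.
by rewrite exprn_ile1// invf_le1// ler1n.
Qed.

Lemma sup_dist_le x y e :
  (forall n, weighted_gap x y n <= e) -> sup_dist x y <= e.
Proof.
move=> he; apply: ge_sup; first by exists (weighted_gap x y 0), 0.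
by move=> _ [n _ <-].
Qed.

Lemma sup_distxx x : sup_dist x x = 0.
Proof.
apply/eqP; rewrite eq_le; apply/andP; split.
  by apply: sup_dist_le => n; rewrite /weighted_gap subrr normr0 mulr0.
exact: le_trans (weighted_gap_ge0 x x 0) (weighted_gap_le_sup_dist x x 0).
Qed.

Lemma sup_dist_sym x y : sup_dist x y = sup_dist y x.
Proof.
rewrite /sup_dist; suff -> : weighted_gap x y = weighted_gap y x by [].
by apply/funext => n; rewrite /weighted_gap distrC.
Qed.

Lemma sup_dist_triangle y x z : sup_dist x z <= sup_dist x y + sup_dist y z.
Proof.
apply: sup_dist_le => n.
apply: le_trans (lerD (weighted_gap_le_sup_dist x y n)
  (weighted_gap_le_sup_dist y z n)).
by rewrite /weighted_gap -mulrDr ler_wpM2l ?exprn_ge0// ler_distD.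
Qed.

Hypothesis f_sep : forall x y, (forall n, f n x = f n y) -> x = y.

Lemma sup_dist_positivity x y : sup_dist x y = 0 -> x = y.
Proof.
move=> xy0; apply: f_sep => n; apply/eqP; rewrite -subr_eq0 -normr_le0.
have := weighted_gap_le_sup_dist x y n; rewrite xy0 /weighted_gap.
by rewrite pmulr_rle0// exprn_gt0.
Qed.

Hypothesis f_cts : forall n, continuous (f n).

(** Only finitely many coordinates matter up to [e], because the weights tend
    to 0. *)
Lemma near_sup_dist_lt x e : 0 < e -> \forall y \near x, sup_dist x y < e.
Proof.
move=> e0; have e20 : 0 < e / 2 by rewrite divr_gt0.
have [N _ Ne] : \forall n \near \oo, 2^-1 ^+ n < e / 2 :> R.
  have half1 : `|2^-1 : R| < 1 by rewrite ger0_norm// invf_lt1// ltr1n.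
  have /cvgrPdist_lt/(_ _ e20) := cvg_expr half1.
  by apply: filterS => n; rewrite sub0r normrN ger0_norm// exprn_ge0.
have Nnear : \forall y \near x, forall n, (n < N)%N -> `|f n x - f n y| < e / 2.
  elim: N {Ne} => [|N IH]; first by near=> y.
  have /cvgrPdist_lt/(_ _ e20) := @f_cts N x.
  apply: filterS2 IH => y IH Ny n; rewrite ltnS leq_eqVlt => /orP[/eqP ->//|].
  exact: IH.
apply: filterS Nnear => y Ny; apply: le_lt_trans (_ : e / 2 < e); last by lra.
apply: sup_dist_le => n; have [nN|Nn] := ltnP n N.
  apply: le_trans (ltW (Ny n nN)); rewrite -[leRHS]mul1r ler_wpM2r//.
  by rewrite exprn_ile1// invf_le1// ler1n.
exact/(le_trans (weighted_gap_le x y n))/ltW/Ne.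
Unshelve. all: by end_near. Qed.

(** The identity from [X] to the metric space is continuous; since [X] is
    compact and a metric space is Hausdorff, it maps closed sets to closed
    sets. *)
Lemma compact_separated_metrisable : compact [set: X] -> metrisable R X.
Proof.
move=> cX.
pose mix := isMetric.Build R X
  sup_distxx sup_dist_positivity sup_dist_sym sup_dist_triangle.
pose M : metricType R := HB.pack (X : Type) (Choice.class X) mix.
have nbhsM (x : X) (U : set X) : @nbhs M M x U <->
    exists2 e, 0 < e & forall y, sup_dist x y < e -> U y.
  rewrite -(@metricType_numDomainType.filter_from_mdist_nbhs R M).
  by split => -[e e0 eU]; exists e.
have X_to_M (x : X) (U : set X) : @nbhs M M x U -> @nbhs X X x U.
  by move=> /nbhsM[e e0 eU]; apply: filterS (near_sup_dist_lt x e0) => y /eU.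
exists (Metric.class M) => x; apply/seteqP; split => U; first exact: X_to_M.
rewrite nbhsE => -[V [Vop Vx] VU].
have cV : compact (~` V) by exact: subclosed_compact (open_closedC Vop) cX _.
have cVM : @compact M (~` V).
  move=> F FF /(cV F FF)[y [Vy Fy]]; exists y; split => //.
  by move=> A B FA /X_to_M; exact: Fy.
have : @open M V.
  rewrite -[V]setCK; apply: closed_openC.
  exact: (compact_closed (@metric_hausdorff R M)).
move=> VMop; have nV : @nbhs M M x V.
  by apply: (@open_nbhs_nbhs M); split.
exact: (@filterS M _ (@nbhs_filter M x) V).
Qed.

End SupMetric.

Lemma compact_countably_separated_metrisable (R : realType)
    (X : topologicalType) (F : set (X -> R)) :
  compact [set: X] -> countable F ->
  (forall f, F f -> continuous f /\ forall x, (0 <= f x <= 1)%R) ->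
  (forall x y, (forall f, F f -> f x = f y) -> x = y) -> metrisable R X.
Proof.
move=> cX cF FP Fsep.
have [f [fP fF]] : exists f : nat -> X -> R,
    (forall n, continuous (f n) /\ forall x, (0 <= f n x <= 1)%R) /\
    forall g, F g -> exists n, f n = g.
  move: cF => /pfcard_geP[->|[u]].
    exists (fun _ _ => 0%R); split => // n.
    by split=> x; [exact: cvg_cst|rewrite lexx ler01].
  exists u; split=> [n|g Fg]; first exact/FP/(@funS _ _ _ _ u).
  by have [n _ <-] := (@surj _ _ _ _ u) g Fg; exists n.
apply: (compact_separated_metrisable (f := f)) => //.
- by move=> n x; have [] := fP n.
- by move=> x y fxy; apply: Fsep => g /fF[n <-].
- by move=> n; have [] := fP n.
Qed.

Theorem corollary1p7 (R : realType) (d : Order.disp_t)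
    (K : orderTopologicalType d) :
  compact [set: K] -> gruenhage_space K -> metrisable R K.
Proof.
move=> cK /gruenhage_stratification[C [col CS]].
have [D cD Dsep] := countable_order_separation cK CS.
pose ury (p : K * K) : K -> R :=
  Urysohn [set x | dir true x p.1] [set x | dir true p.2 x].
apply: (compact_countably_separated_metrisable (F := ury @` (D `*` D))) => //.
- exact: card_le_trans (card_image_le _ _) (countableX cD cD).
- move=> _ [p _ <-]; split=> [|x]; first exact: Urysohn_continuous.
  have /(_ (ury p x)) := @Urysohn_range K R
    [set x | dir true x p.1] [set x | dir true p.2 x].
  by rewrite /= in_itv/=; apply; exists x.
move=> x y; have sep z w : (z < w)%O ->
    ~ forall f, (ury @` (D `*` D)) f -> f z = f w.
  move=> /Dsep[e [g [De Dg ze eg gw]]] /(_ (ury (e, g))) zw.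
  have eg_sep : uniform_separator [set t | dir true t e] [set t | dir true g t].
    apply: (normal_separatorP (R := R)).1.
    + exact: compact_normal order_hausdorff cK.
    + exact: dir_closed_lower.
    + exact: dir_closed_upper.
    + apply/disjoints_subset => t te; apply/negP; rewrite -ltNge.
      exact: le_lt_trans te eg.
  have z0 : ury (e, g) z = 0%R by apply: (Urysohn_sub0 eg_sep); exists z.
  have w1 : ury (e, g) w = 1%R by apply: (Urysohn_sub1 eg_sep); exists w.
  have /eqP : ury (e, g) z = ury (e, g) w by apply: zw; exists (e, g).
  by rewrite z0 w1 eq_sym oner_eq0.
move=> xy; apply: contrapT => /eqP; rewrite neq_lt => /orP[/sep//|/sep].
by apply=> f /xy.
Qed.
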